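(* Assume that $\partial^s(P)=\partial^w(P)$. Then the extended max Russell graph measure $\hat F(\cdot,\cdot;T)$ on $T=T_{\mathrm{VRS\text{-}TO}}$ satisfies the following two properties. (I) (Indication of efficiency) For all $(\bm{x},\bm{y})\in T$, $\hat F(\bm{x},\bm{y};T)=1$ if and only if $(\bm{x},\bm{y})\in\partial^s(T)$. (SM) (Strong monotonicity) For all $(\bm{x},\bm{y})\in T$ and $(\bm{x}',\bm{y}')\in T$ with $(\bm{x},-\bm{y})\le(\bm{x}',-\bm{y}')$ and $(\bm{x},-\bm{y})\ne(\bm{x}',-\bm{y}')$, one has $\hat F(\bm{x},\bm{y};T)>\hat F(\bm{x}',\bm{y}';T)$.
   Context: Vector inequalities are componentwise ($>$ means strict in every component). $\mathbb{R}^D_+$ is the nonnegative orthant and $\bar{\mathbb{R}}^D_+=\mathbb{R}^D_+\setminus\{\bm 0\}$. Data: positive integers $m,s,n,K$; vectors $(\bm{x}_j,\bm{y}_j)\in\bar{\mathbb{R}}^m_+\times\bar{\mathbb{R}}^s_+$ for $j=1,\dots,n$ (observed input and output vectors); and arbitrary trade-off vectors $(\bm{r}^-_t,\bm{r}^+_t)\in\mathbb{R}^m\times\mathbb{R}^s$ for $t=1,\dots,K$. Define $$P=\Big\{(\bm{x},\bm{y})\in\mathbb{R}^m\times\mathbb{R}^s:\ \exists \lambda_1,\dots,\lambda_n\ge0,\ \pi_1,\dots,\pi_K\ge0,\ \sum_{j}\lambda_j=1,\ \sum_{j}\lambda_j\bm{x}_j+\sum_t\pi_t\bm{r}^-_t\le\bm{x},\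 \sum_j\lambda_j\bm{y}_j+\sum_t\pi_t\bm{r}^+_t\ge\bm{y}\Big\},$$ and the production possibility set $T_{\mathrm{VRS\text{-}TO}}=P\cap(\mathbb{R}^m_+\times\bar{\mathbb{R}}^s_+)$. It is assumed that $P\ne\mathbb{R}^{m}\times\mathbb{R}^s$ (so that $P$ has at least one facet). For a set $S\subseteq\mathbb{R}^m\times\mathbb{R}^s$ (used for $S=P$ and $S=T_{\mathrm{VRS\text{-}TO}}$), the strongly and weakly efficient frontiers are $\partial^s(S)=\{(\bm{x},\bm{y})\in S:\ (\bm{x},-\bm{y})\ge(\bm{x}',-\bm{y}')\text{ and }(\bm{x},-\bm{y})\ne(\bm{x}',-\bm{y}')\text{ imply }(\bm{x}',\bm{y}')\notin S\}$ and $\partial^w(S)=\{(\bm{x},\bm{y})\in S:\ (\bm{x},-\bm{y})>(\bm{x}',-\bm{y}')\text{ implies }(\bm{x}',\bm{y}')\notin S\}$. For $\bm\theta\in\mathbb{R}^m,\bm\phi\in\mathbb{R}^s$ write $\bm\theta\otimes\bm{x}=(\theta_1x_1,\dots,\theta_mx_m)$, $\bm\phi\otimes\bm{y}=(\phi_1y_1,\dots,\phi_sy_s)$, and $f(\bm\theta,\bm\phi)=\frac1{m+s}\big(\sum_{i=1}^m\theta_i+\sum_{r=1}^s\frac1{\phi_r}\big)$. For $(\bm{x},\bm{y})\in T_{\mathrm{VRS\text{-}TO}}$, the extended max Russell graph measure $\hat F(\bm{x},\bm{y};T_{\mathrm{VRS\text{-}TO}})$ is the optimal value of $$\max\{f(\bm\theta,\bm\phi):\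 (\bm\theta\otimes\bm{x},\bm\phi\otimes\bm{y})\in\partial^s(T_{\mathrm{VRS\text{-}TO}}),\ 0\le\theta_i\le1\ (i=1,\dots,m),\ \phi_r\ge1\ (r=1,\dots,s)\}.$$ *)

(* Defs.v *)
From mathcomp Require Import all_boot all_order all_algebra.
From mathcomp Require Import all_classical all_reals.

Set Implicit Arguments.
Unset Strict Implicit.
Unset Printing Implicit Defensive.

Import Order.TTheory GRing.Theory Num.Theory.
Local Open Scope ring_scope.
Local Open Scope classical_set_scope.

Definition lev (R : realType) (D : nat) (u v : 'rV[R]_D) : Prop :=
  forall i, u 0 i <= v 0 i.

Definition ltv (R : realType) (D : nat) (u v : 'rV[R]_D) : Prop :=
  forall i, u 0 i < v 0 i.

Definition orthant {R : realType} {D : nat} : set 'rV[R]_D :=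
  [set u | lev 0 u].

Definition orthant_neq0 {R : realType} {D : nat} : set 'rV[R]_D :=
  orthant `\ 0.

Definition hadamard (R : realType) (D : nat) (u v : 'rV[R]_D) : 'rV[R]_D :=
  map2_mx *%R u v.

(* The vector (x, -y) of R^(m+s): smaller means less input and more output. *)
Definition netput (R : realType) (m s : nat) (p : 'rV[R]_m * 'rV[R]_s) :
    'rV[R]_(m + s) :=
  row_mx p.1 (- p.2).

Definition strong_frontier (R : realType) (m s : nat)
    (S : set ('rV[R]_m * 'rV[R]_s)) : set ('rV[R]_m * 'rV[R]_s) :=
  [set p | S p /\
    forall p', lev (netput p') (netput p) -> netput p <> netput p' -> ~ S p'].

Definition weak_frontier (R : realType) (m s : nat)
    (S : set ('rV[R]_m * 'rV[R]_s)) : set ('rV[R]_m * 'rV[R]_s) :=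
  [set p | S p /\ forall p', ltv (netput p') (netput p) -> ~ S p'].

Definition PTO (R : realType) (m s n K : nat)
    (x : 'I_n -> 'rV[R]_m) (y : 'I_n -> 'rV[R]_s)
    (rm : 'I_K -> 'rV[R]_m) (rp : 'I_K -> 'rV[R]_s) :
    set ('rV[R]_m * 'rV[R]_s) :=
  [set p | exists (lam : 'I_n -> R) (pi : 'I_K -> R),
    [/\ forall j, 0 <= lam j,
        forall t, 0 <= pi t,
        \sum_j lam j = 1,
        lev (\sum_j lam j *: x j + \sum_t pi t *: rm t) p.1 &
        lev p.2 (\sum_j lam j *: y j + \sum_t pi t *: rp t)]].

Definition TVRSTO (R : realType) (m s n K : nat)
    (x : 'I_n -> 'rV[R]_m) (y : 'I_n -> 'rV[R]_s)
    (rm : 'I_K -> 'rV[R]_m) (rp : 'I_K -> 'rV[R]_s) :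
    set ('rV[R]_m * 'rV[R]_s) :=
  PTO x y rm rp `&` (orthant `*` orthant_neq0).

Definition russell_obj (R : realType) (m s : nat)
    (theta : 'rV[R]_m) (phi : 'rV[R]_s) : R :=
  (m + s)%:R^-1 * (\sum_i theta 0 i + \sum_r (phi 0 r)^-1).

Definition russell_feasible (R : realType) (m s : nat)
    (T : set ('rV[R]_m * 'rV[R]_s)) (p : 'rV[R]_m * 'rV[R]_s) :
    set ('rV[R]_m * 'rV[R]_s) :=
  [set q | [/\ strong_frontier T (hadamard q.1 p.1, hadamard q.2 p.2),
               forall i, 0 <= q.1 0 i <= 1 &
               forall r, 1 <= q.2 0 r]].

(* The greatest element of A, or -oo if A has none. *)
Definition max_value (R : realType) (A : set R) : \bar R :=
  xget -oo%E (EFin @` (A `&` ubound A)).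

(* The optimal value of the maximization program. The value -oo means that the
   maximum is not attained (in particular, that the program is infeasible). *)
Definition max_russell (R : realType) (m s : nat)
    (T : set ('rV[R]_m * 'rV[R]_s)) (p : 'rV[R]_m * 'rV[R]_s) : \bar R :=
  max_value [set russell_obj q.1 q.2 | q in russell_feasible T p].

(* Main.v *)
Require Import Defs.
From mathcomp Require Import all_boot all_order all_algebra.
From mathcomp Require Import all_classical all_reals.
From mathcomp Require Import topology normedtype derive.
From mathcomp Require Import ring lra.

(** Write [S] for the polyhedral set of the theorem and [T] for its part with
    nonnegative inputs and outputs and nonzero output.

    Everything rests on one topological fact: [S] is closed.  It is the
    projection of a polyhedron along the intensity variables, so Fourier-Motzkin
    elimination ([eliminate_variable], [closed_solvable]) describes it by
    finitely many weak inequalities between continuous functions.  The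
    improvable points (those that stay in [S] when all inputs fall and all
    outputs rise by some common e > 0) always form an open set.  Hence the weak
    frontier is closed, and by connectedness every path that leaves [S] meets
    the weak frontier ([frontier_crossing]).

    The equality of the two frontiers of [S] has two consequences.  First, no
    output can grow forever: otherwise its direction would be a recession
    direction of the closed convex set [S], and a weakly efficient point could
    move along it ([no_output_recession]).  Second, a point of [T] is strongly
    efficient in [T] iff it is weakly efficient in [S]
    ([strong_frontier_restrict]): an improvable point of [T] can raise its
    outputs without lowering its inputs, so it remains in [T] and is dominated
    there.  So feasibility of a scaling means landing on a closed set, and
    outputs are bounded; the maximum is attained ([russell_optimal_exists]),
    since scalings of the zero outputs may be reset to 1.

    Indication of efficiency holds because the objective is at most 1, with
    equality only for the trivial scaling ([russell_obj_mono]).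

    For strong monotonicity let [p] dominate [p'] and let [q'] be optimal for
    [p'].  An optimal input scaling is never zero ([optimal_inputs_gt0]): raising
    a zero factor to 1 gains 1, and returning to the frontier by enlarging one
    output factor phi costs less than 1 / phi <= 1.  Therefore [q'] rescales [p]
    to a point distinct from, and dominating, the strongly efficient rescaling
    of [p'], hence to a point outside [S].  The segment from the trivial scaling
    to [q'] crosses the frontier before [q'], at a feasible scaling of [p] with
    strictly larger objective. *)

Set Implicit Arguments.
Unset Strict Implicit.
Unset Printing Implicit Defensive.

Import Order.TTheory GRing.Theory Num.Theory.
Import numFieldNormedType.Exports.
Local Open Scope ring_scope.
Local Open Scope classical_set_scope.

(** * Fourier-Motzkin elimination *)

Section FourierMotzkin.
Context {R : realType}.

(** Each constraint with c i > 0 bounds t below and each one with c j < 0 bounds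
    it above; the pair condition says that every lower bound is at most every
    upper bound.  As there are finitely many constraints, the smallest of the
    upper bounds is attained and, if there is any, is a solution. *)
Lemma eliminate_variable (I : finType) (a c : I -> R) :
  (exists t, forall i, 0 <= a i + c i * t) <->
  (forall i, c i = 0 -> 0 <= a i) /\
  (forall i j, 0 < c i -> c j < 0 -> 0 <= c i * a j - c j * a i).
Proof.
split=> [[t at0]|[zero pair]].
  split=> [i ci0|i j ci cj]; first by have := at0 i; rewrite ci0 mul0r addr0.
  have -> : c i * a j - c j * a i =
    c i * (a j + c j * t) + (- c j) * (a i + c i * t) by ring.
  by rewrite addr_ge0 // mulr_ge0 ?at0 ?oppr_ge0 // ltW.
have [[j0 cj0]|noneg] := pselect (exists j, c j < 0).
  case: (@arg_minP _ R I j0 (fun j => c j < 0) (fun j => a j / - c j) cj0).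
  move=> j cj minj.
  exists (a j / - c j) => i.
  have cjN0 : 0 < - c j by rewrite oppr_gt0.
  have aj : a j = (- c j) * (a j / - c j).
    by rewrite mulrC divfK // gt_eqF.
  case: (ltrgt0P (c i)) => ci.
  - have := pair i j ci cj.
    have -> : c i * a j - c j * a i =
      (- c j) * (a i + c i * (a j / (- c j))) by rewrite {1}aj; ring.
    by rewrite pmulr_rge0.
  - have := minj i ci; rewrite (ler_pdivlMr _ _ (_ : 0 < - c i)) ?oppr_gt0 //; lra.
  - by rewrite ci mul0r addr0 zero.
(* Without upper bounds, any t above the sum of all |lower bounds| works. *)
exists (\sum_i `|a i / c i|) => i.
have ci : 0 <= c i by rewrite leNgt; apply/negP => ci; apply: noneg; exists i.
move: ci; rewrite le_eqVlt => /predU1P[/esym ci|ci].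
  by rewrite ci mul0r addr0 zero.
have : - (a i / c i) <= \sum_k `|a k / c k|.
  rewrite (le_trans (ler_norm _)) // normrN (bigD1 i) //= lerDl.
  by rewrite sumr_ge0.
rewrite -(ler_pM2l ci) mulrN mulrCA divff ?mulr1 ?gt_eqF //; lra.
Qed.

(** The coefficients of the unknowns are constant, so eliminating one unknown
    combines the functions g linearly with constant weights, and they stay
    continuous; after all unknowns are gone, the set is an intersection of
    preimages of a closed half-line. *)
Lemma closed_solvable_ord {Z : topologicalType} (N : nat) (I : finType)
    (g : I -> Z -> R) (c : I -> 'I_N -> R) :
  (forall i, continuous (g i)) ->
  closed [set z | exists mu : 'I_N -> R,
    forall i, 0 <= g i z + \sum_k c i k * mu k].
Proof.
elim: N I g c => [|N IH] I g c gC.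
  rewrite (_ : [set z | _] = \bigcap_i (g i @^-1` [set u : R | 0 <= u])).
    apply: closed_bigI => i _; apply: closed_comp; last exact: closed_ge.
    by move=> z _; exact: gC.
  apply/seteqP; split=> z /=.
    by move=> [mu h] i _ /=; have := h i; rewrite big_ord0 addr0.
  by move=> h; exists (fun=> 0) => i; rewrite big_ord0 addr0; exact: h.
(* One new constraint per pair (i, j): constraint i itself if it does not
   involve the unknown, the positive combination that cancels the unknown if i
   bounds it below and j above, and the trivial 0 <= 0 otherwise. *)
pose alpha (p : I * I) : R :=
  if c p.1 ord0 == 0 then 1
  else if (0 < c p.1 ord0) && (c p.2 ord0 < 0) then - c p.2 ord0 else 0.
pose beta (p : I * I) : R :=
  if c p.1 ord0 == 0 then 0
  else if (0 < c p.1 ord0) && (c p.2 ord0 < 0) then c p.1 ord0 else 0.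
pose g' p z := alpha p * g p.1 z + beta p * g p.2 z.
pose c' p k := alpha p * c p.1 (lift ord0 k) + beta p * c p.2 (lift ord0 k).
rewrite (_ : [set z | _] = [set z | exists mu : 'I_N -> R,
    forall p, 0 <= g' p z + \sum_k c' p k * mu k]).
  apply: IH => p z; rewrite /g'.
  by apply: cvgD; apply: cvgM; (try exact: cvg_cst); exact: gC.
pose a (mu : 'I_N -> R) z i := g i z + \sum_k c i (lift ord0 k) * mu k.
have combine mu z p : g' p z + \sum_k c' p k * mu k =
    alpha p * a mu z p.1 + beta p * a mu z p.2.
  rewrite /g' /c' /a !mulrDr !mulr_sumr addrACA -big_split /=.
  by congr (_ + _); apply: eq_bigr => k _; ring.
have elim_ mu z : (exists t, forall i, 0 <= a mu z i + c i ord0 * t) <->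
    forall p, 0 <= g' p z + \sum_k c' p k * mu k.
  rewrite eliminate_variable; split=> [[zero pair] [i j]|h].
    rewrite combine /alpha /beta /=; case: eqP => [/zero|ci0].
      by rewrite mul1r mul0r addr0.
    case: ifP => [/andP[ci cj]|_]; last by rewrite !mul0r addr0.
    by have := pair i j ci cj; rewrite mulNr addrC.
  split=> [i ci|i j ci cj].
    by have := h (i, i); rewrite combine /alpha /beta /= ci eqxx mul1r mul0r addr0.
  have := h (i, j).
  by rewrite combine /alpha /beta /= (gt_eqF ci) ci cj /= mulNr addrC.
apply/seteqP; split=> z /= [mu h].
  exists (fun k => mu (lift ord0 k)); apply/elim_; exists (mu ord0) => i.
  by have := h i; rewrite big_ord_recl /a; lra.
have /elim_[t ht] := h.
exists (fun k => if unlift ord0 k is Some k' then mu k' else t) => i.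
rewrite big_ord_recl unlift_none.
under eq_bigr do rewrite liftK.
by have := ht i; rewrite /a; lra.
Qed.

Lemma closed_solvable {Z : topologicalType} (V I : finType)
    (g : I -> Z -> R) (c : I -> V -> R) :
  (forall i, continuous (g i)) ->
  closed [set z | exists2 mu : V -> R, forall k, 0 <= mu k &
    forall i, 0 <= g i z + \sum_k c i k * mu k].
Proof.
move=> gC.
pose G (i : I + V) z : R := if i is inl i then g i z else 0.
pose C (i : I + V) (k : 'I_#|V|) : R :=
  match i with inl i => c i (enum_val k) | inr v => (enum_val k == v)%:R end.
have GC i : continuous (G i).
  by case: i => [i|v]; [exact: gC | move=> z; exact: cvg_cst].
have := @closed_solvable_ord Z _ _ G C GC; congr closed.
have sumE (F : V -> R) : \sum_k F k = \sum_(k < #|V|) F (enum_val k).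
  by rewrite -(big_enum_val (A := V) F).
apply/seteqP; split=> z /=.
  move=> [mu h]; exists (fun v => mu (enum_rank v)) => [v|i].
    have := h (inr v); rewrite /= add0r (bigD1 (enum_rank v)) //=.
    rewrite enum_rankK eqxx mul1r big1 ?addr0 // => k.
    by rewrite -(inj_eq enum_val_inj) enum_rankK => /negPf->; rewrite mul0r.
  rewrite sumE; under eq_bigr => k _ do rewrite enum_valK.
  exact: h (inl i).
move=> [mu mu0 h]; exists (fun k => mu (enum_val k)) => -[i|v] /=.
  by have := h i; rewrite sumE.
rewrite add0r sumr_ge0 // => k _; case: eqP => _; rewrite ?mul0r //.
by rewrite mul1r.
Qed.

End FourierMotzkin.

(** * Netput order and continuity of coordinates *)

Section Netputs.
Context {R : realType} {m s : nat}.
Implicit Types p q : 'rV[R]_m * 'rV[R]_s.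

Lemma netput_le p q :
  lev (netput p) (netput q) <-> lev p.1 q.1 /\ lev q.2 p.2.
Proof.
rewrite /lev /netput; split=> [h|[h1 h2] i].
  split=> i; first by have := h (lshift s i); rewrite !row_mxEl.
  by have := h (rshift m i); rewrite !row_mxEr !mxE lerN2.
by case: (split_ordP i) => j ->;
  rewrite ?row_mxEl ?row_mxEr ?mxE ?lerN2.
Qed.

Lemma netput_lt p q :
  ltv (netput p) (netput q) <-> ltv p.1 q.1 /\ ltv q.2 p.2.
Proof.
rewrite /ltv /netput; split=> [h|[h1 h2] i].
  split=> i; first by have := h (lshift s i); rewrite !row_mxEl.
  by have := h (rshift m i); rewrite !row_mxEr !mxE ltrN2.
by case: (split_ordP i) => j ->;
  rewrite ?row_mxEl ?row_mxEr ?mxE ?ltrN2.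
Qed.

Lemma netput_inj : injective (@netput R m s).
Proof. by move=> [p1 p2] [q1 q2] /eq_row_mx[/= -> /oppr_inj->]. Qed.

End Netputs.

Lemma input_coord_continuous {R : realType} {m s : nat} (i : 'I_m) :
  continuous (fun q : 'rV[R]_m * 'rV[R]_s => q.1 0 i).
Proof.
move=> q; apply: (@continuous_comp _ _ _ fst (fun v : 'rV[R]_m => v 0 i)).
  exact: cvg_fst.
exact: coord_continuous.
Qed.

Lemma output_coord_continuous {R : realType} {m s : nat} (r : 'I_s) :
  continuous (fun q : 'rV[R]_m * 'rV[R]_s => q.2 0 r).
Proof.
move=> q; apply: (@continuous_comp _ _ _ snd (fun v : 'rV[R]_s => v 0 r)).
  exact: cvg_snd.
exact: coord_continuous.
Qed.

Lemma rV_continuous {R : realType} {Z : topologicalType} {D : nat}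
    (a : Z -> 'rV[R]_D) :
  (forall i, continuous (fun z => a z 0 i)) -> continuous a.
Proof.
move=> aC z; apply/cvg_ballP => e e0.
have : \forall z' \near z, forall i, ball (a z 0 i) e (a z' 0 i).
  by apply: filter_forall => i; have /cvg_ballP := aC i z; apply.
by apply: filterS => z' h; split=> // k i; rewrite !ord1.
Qed.

Lemma continuous_pair {T U V : topologicalType} (a : T -> U) (b : T -> V) :
  continuous a -> continuous b -> continuous (fun t => (a t, b t)).
Proof. by move=> aC bC t; apply: cvg_pair; [exact: aC|exact: bC]. Qed.

Lemma segment_continuous {R : realType} {V : normedModType R} (p q : V) :
  continuous (fun t : R => (1 - t) *: p + t *: q).
Proof.
move=> t; apply: cvgD; apply: cvgZr_tmp; last exact: cvg_id.
by apply: cvgB; [exact: cvg_cst|exact: cvg_id].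
Qed.

(** * The technology is closed, freely disposable and convex *)

Lemma combination_coord {R : realType} {L D : nat} (u : 'I_L -> R)
    (w : 'I_L -> 'rV[R]_D) i :
  (\sum_j u j *: w j) 0 i = \sum_j w j 0 i * u j.
Proof. by rewrite summxE; apply: eq_bigr => j _; rewrite mxE mulrC. Qed.

Section TechnologyProperties.
Context {R : realType} {m s n K : nat}.
Context (x : 'I_n -> 'rV[R]_m) (y : 'I_n -> 'rV[R]_s).
Context (rm : 'I_K -> 'rV[R]_m) (rp : 'I_K -> 'rV[R]_s).
Local Notation P := (PTO x y rm rp).

(** The unknowns are the intensities lambda and pi; the equation sum lambda = 1 is
    entered as two inequalities, indexed by a boolean. *)
Lemma PTO_closed : closed P.
Proof.
pose I : finType := ('I_m + 'I_s + bool)%type.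
pose V : finType := ('I_n + 'I_K)%type.
pose g (i : I) (p : 'rV[R]_m * 'rV[R]_s) : R :=
  match i with
  | inl (inl i) => p.1 0 i | inl (inr r) => - p.2 0 r
  | inr b => if b then 1 else -1
  end.
pose c (i : I) (k : V) : R :=
  match i, k with
  | inl (inl i), inl j => - x j 0 i | inl (inl i), inr t => - rm t 0 i
  | inl (inr r), inl j => y j 0 r | inl (inr r), inr t => rp t 0 r
  | inr b, inl _ => if b then -1 else 1 | inr _, inr _ => 0
  end.
have gC i : continuous (g i).
  case: i => [[i|r]|b] z; last exact: cvg_cst.
    exact: input_coord_continuous.
  apply: (@continuousN _ _ _ (fun p : 'rV[R]_m * 'rV[R]_s => p.2 0 r)).
  exact: output_coord_continuous.
have := @closed_solvable R _ V I g c gC; congr closed.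
apply/seteqP; split=> -[p1 p2] /=.
  move=> [mu mu0 h]; exists (fun j => mu (inl j)), (fun t => mu (inr t)); split.
  - by move=> j; exact: mu0.
  - by move=> t; exact: mu0.
  - apply/eqP; rewrite eq_le.
    have := h (inr true); have := h (inr false).
    rewrite !big_sumType /=.
    under eq_bigr do rewrite mul1r.
    under [X in _ + (_ + X)]eq_bigr do rewrite mul0r.
    rewrite big1_eq addr0 => le1.
    under eq_bigr do rewrite mulN1r.
    under [X in _ + (_ + X)]eq_bigr do rewrite mul0r.
    by rewrite big1_eq sumrN; lra.
  - move=> i; have := h (inl (inl i)); rewrite big_sumType /=.
    under eq_bigr do rewrite mulNr.
    under [X in _ + (_ + X)]eq_bigr do rewrite mulNr.
    by rewrite !sumrN mxE !combination_coord; lra.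
  - move=> r; have := h (inl (inr r)); rewrite big_sumType /=.
    by rewrite mxE !combination_coord; lra.
move=> [lam [pi [lam0 pi0 lam1 hx hy]]].
exists (fun k => match k with inl j => lam j | inr t => pi t end) => [[j|t]//|].
case=> [[i|r]|b]; rewrite big_sumType /=.
- have := hx i; rewrite mxE !combination_coord => le1.
  under eq_bigr do rewrite mulNr.
  under [X in _ + (_ + X)]eq_bigr do rewrite mulNr.
  by rewrite !sumrN; lra.
- by have := hy r; rewrite mxE !combination_coord; lra.
- under [X in _ + (_ + X)]eq_bigr do rewrite mul0r.
  rewrite big1_eq addr0 -mulr_sumr lam1; case: b; lra.
Qed.

Lemma PTO_disposal p q :
  P p -> lev p.1 q.1 -> lev q.2 p.2 -> P q.
Proof.
move=> [lam [pi [lam0 pi0 lam1 hx hy]]] le1 le2.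
exists lam, pi; split=> // i.
  exact: le_trans (hx i) (le1 i).
exact: le_trans (le2 i) (hy i).
Qed.

Lemma PTO_convex p q t : P p -> P q -> 0 <= t <= 1 ->
  P ((1 - t) *: p + t *: q).
Proof.
move=> [lam [pi [lam0 pi0 lam1 hx hy]]] [lam' [pi' [lam'0 pi'0 lam'1 hx' hy']]].
case/andP=> t0 t1; have t1' : 0 <= 1 - t by rewrite subr_ge0.
have mix (L : nat) (D : nat) (u v : 'I_L -> R) (w : 'I_L -> 'rV[R]_D) :
    \sum_j ((1 - t) * u j + t * v j) *: w j =
    (1 - t) *: (\sum_j u j *: w j) + t *: (\sum_j v j *: w j).
  rewrite !scaler_sumr -big_split /=; apply: eq_bigr => j _.
  by rewrite scalerDl !scalerA.
exists (fun j => (1 - t) * lam j + t * lam' j),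
  (fun j => (1 - t) * pi j + t * pi' j); split.
- by move=> j; rewrite addr_ge0 ?mulr_ge0.
- by move=> j; rewrite addr_ge0 ?mulr_ge0.
- by rewrite big_split /= -!mulr_sumr lam1 lam'1; ring.
- move=> i; rewrite !mix /= !mxE.
  have := ler_wpM2l t1' (hx i); have := ler_wpM2l t0 (hx' i).
  by rewrite !mxE; lra.
- move=> i; rewrite !mix /= !mxE.
  have := ler_wpM2l t1' (hy i); have := ler_wpM2l t0 (hy' i).
  by rewrite !mxE; lra.
Qed.

End TechnologyProperties.

(** * Frontiers of a closed, freely disposable set *)

Definition improve {R : realType} {m s : nat} (e : R)
    (p : 'rV[R]_m * 'rV[R]_s) : 'rV[R]_m * 'rV[R]_s :=
  (p.1 - const_mx e, p.2 + const_mx e).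

Lemma uniform_gap {R : realType} {D : nat} (u v : 'rV[R]_D) :
  ltv u v -> exists2 e, 0 < e & forall i, u 0 i + e <= v 0 i.
Proof.
move=> uv; exists (\big[Num.min/1]_i (v 0 i - u 0 i)).
  apply: (big_ind (fun z => 0 < z)) => //; last by move=> i _; rewrite subr_gt0.
  by move=> a b a0 b0; rewrite lt_min a0.
by move=> i; rewrite -lerBrDl; exact: bigmin_le.
Qed.

Section ProductionSet.
Context {R : realType} {m s : nat}.
Context {S : set ('rV[R]_m * 'rV[R]_s)}.
Hypothesis S_closed : closed S.
Hypothesis S_disposal :
  forall p q, S p -> lev p.1 q.1 -> lev q.2 p.2 -> S q.

(** By free disposal, a strict improvement in every coordinate may be taken by
    the same amount e in all of them. *)
Lemma weak_frontierP p :
  weak_frontier S p <-> S p /\ forall e, 0 < e -> ~ S (improve e p).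
Proof.
split=> [[Sp wp]|[Sp wp]]; split=> //.
  move=> e e0; apply: wp; apply/netput_lt.
  by split=> i /=; rewrite !mxE; lra.
move=> q /netput_lt[/uniform_gap[a a0 ha] /uniform_gap[b b0 hb]] Sq.
apply: (wp (Num.min a b)); first by rewrite lt_min a0.
apply: S_disposal Sq _ _ => i /=; rewrite !mxE.
  have := ha i; have : Num.min a b <= a by rewrite ge_min lexx.
  lra.
have := hb i; have : Num.min a b <= b by rewrite ge_min lexx orbT.
lra.
Qed.

(** Half of the improvement e survives a perturbation smaller than e / 2. *)
Lemma improvable_open : open [set p | exists2 e, 0 < e & S (improve e p)].
Proof.
rewrite openE => p [e e0 Se]; apply/nbhs_ballP; exists (e / 2) => /=.
  by rewrite divr_gt0.
move=> q [[_ b1] [_ b2]]; exists (e / 2); first by rewrite divr_gt0.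
apply: S_disposal Se _ _ => i /=; rewrite !mxE.
  have := b1 0 i; rewrite /ball /= ltr_norml => /andP[]; lra.
have := b2 0 i; rewrite /ball /= ltr_norml => /andP[]; lra.
Qed.

Lemma improvable_in p e : 0 < e -> S (improve e p) -> S p.
Proof.
by move=> e0 Sp; apply: S_disposal Sp _ _ => i /=; rewrite !mxE; lra.
Qed.

Lemma weak_frontier_closed : closed (weak_frontier S).
Proof.
rewrite (_ : weak_frontier S =
    S `&` ~` [set p | exists2 e, 0 < e & S (improve e p)]).
  exact: closedI S_closed (open_closedC improvable_open).
apply/seteqP; split=> p; first by move/weak_frontierP => [Sp h]; split=> // -[e /h].
move=> [Sp h]; apply/weak_frontierP; split=> // e e0 Se; apply: h.
by exists e.
Qed.

(** If the path avoided the weak frontier, the times spent in S would form a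
    subset of [0, 1] that is both closed (S is) and open (all these points would
    be improvable), hence all of [0, 1]. *)
Lemma frontier_crossing (f : R -> 'rV[R]_m * 'rV[R]_s) :
  continuous f -> S (f 0) -> ~ S (f 1) ->
  exists2 t, 0 <= t < 1 & weak_frontier S (f t).
Proof.
move=> fC S0 S1; apply: contrapT => none.
have improvable t : 0 <= t <= 1 -> S (f t) ->
    exists2 e, 0 < e & S (improve e (f t)).
  move=> /andP[t0 t1] St; apply: contrapT => ne; apply: none; exists t.
    rewrite t0 lt_neqAle t1 andbT; apply/eqP => t1E.
    by apply: S1; rewrite -t1E.
  apply/weak_frontierP; split=> // e e0 Se.
  by apply: ne; exists e.
have in01 (t : R) : `[0, 1] t = (0 <= t <= 1) :> Prop by rewrite /= in_itv.
suff E : `[0, 1] `&` f @^-1` S = `[0, 1].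
  have : `[0, (1 : R)] 1 by rewrite in01 ler01 lexx.
  by rewrite -E => -[_ /S1].
apply: segment_connected.
- by exists 0; split; rewrite ?in01 ?lexx ?ler01.
- exists (f @^-1` [set p | exists2 e, 0 < e & S (improve e p)]).
    by apply: open_comp improvable_open => t _; exact: fC.
  apply/seteqP; split=> t [t01 /=]; last first.
    by move=> [e e0 /(improvable_in e0)].
  by move=> St; split=> //; apply: improvable => //; rewrite -in01.
- by exists (f @^-1` S) => //; apply: closed_comp S_closed => t _; exact: fC.
Qed.

(** * Consequences of the equality of the two frontiers *)

Hypothesis S_convex :
  forall p q t, S p -> S q -> 0 <= t <= 1 -> S ((1 - t) *: p + t *: q).
Hypothesis S_proper : S <> setT.
Hypothesis S_frontiers : strong_frontier S = weak_frontier S.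

Lemma strong_frontier_point p : S p -> exists z, strong_frontier S z.
Proof.
move=> Sp; have [q Sq] : exists q, ~ S q.
  apply: contrapT => h; apply: S_proper; apply/seteqP; split=> // q _.
  by apply: contrapT => Sq; apply: h; exists q.
have [t _ wt] : exists2 t, 0 <= t < 1 &
    weak_frontier S ((1 - t) *: p + t *: q).
  apply: (@frontier_crossing (fun t => (1 - t) *: p + t *: q)).
  - exact: segment_continuous.
  - by rewrite subr0 scale1r scale0r addr0.
  - by rewrite subrr scale0r scale1r add0r.
by eexists; rewrite S_frontiers; exact: wt.
Qed.

(** If S contained the whole ray, it would contain z + e_r for every z in S, as a
    limit of points (1 - t) z + t (u, v + e_r / t) on segments from z to the ray.
    This contradicts the strong efficiency of some z. *)
Lemma no_output_recession u v (r : 'I_s) :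
  exists2 t, 0 <= t & ~ S (u, v + t *: delta_mx 0 r).
Proof.
apply: contrapT => none.
have ray t : 0 <= t -> S (u, v + t *: delta_mx 0 r).
  by move=> t0; apply: contrapT => h; apply: none; exists t.
have [z [Sz sz]] := strong_frontier_point (ray 0 (lexx 0)).
pose w : 'rV[R]_m * 'rV[R]_s := (0, delta_mx 0 r).
pose f t := (1 - t) *: z + t *: (u, v) + w.
have Sf t : 0 < t <= 1 -> S (f t).
  move=> /andP[t0 t1].
  have -> : f t = (1 - t) *: z + t *: (u, v + t^-1 *: delta_mx 0 r).
    rewrite /f /w -addrA; congr (_ + _).
    rewrite -[LHS]/(t *: u + 0, t *: v + delta_mx 0 r).
    rewrite -[RHS]/(t *: u, t *: (v + t^-1 *: delta_mx 0 r)).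
    by rewrite addr0 scalerDr scalerA divff ?scale1r // gt_eqF.
  apply: S_convex => //; last by rewrite (ltW t0).
  by apply: ray; rewrite invr_ge0 ltW.
have : S (f 0).
  apply: contrapT => nS.
  have : nbhs (0 : R) (f @^-1` ~` S).
    apply: (cvgD (segment_continuous (p := z) (q := (u, v)) (x := 0)) (cvg_cst w)).
    rewrite -/(f 0); apply: open_nbhs_nbhs.
    by split=> //; exact: closed_openC.
  move=> /nbhs_ballP[e /= e0 he].
  pose t := Num.min (e / 2) 1.
  have te : t <= e / 2 by rewrite ge_min lexx.
  have t1 : t <= 1 by rewrite ge_min lexx orbT.
  have t0 : 0 < t by rewrite lt_min ltr01 divr_gt0.
  apply: (he t); last by apply: Sf; rewrite t0.
  by rewrite /ball /= sub0r normrN gtr0_norm //; lra.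
rewrite /f subr0 scale1r scale0r addr0; apply: sz.
  apply/netput_le; split=> i /=; rewrite !mxE; first by rewrite addr0.
  by rewrite lerDl eqxx ler0n.
move/netput_inj => E; have := congr1 (fun p : 'rV[R]_m * 'rV[R]_s => p.2 0 r) E.
rewrite /= !mxE !eqxx /= => /eqP.
by rewrite -subr_eq0 opprD addNKr oppr_eq0 oner_eq0.
Qed.

Lemma output_bounded u r :
  exists B, forall v, lev 0 v -> S (u, v) -> v 0 r <= B.
Proof.
have [t t0 nS] := no_output_recession u 0 r; exists t => v v0 Sv.
rewrite leNgt; apply/negP => tv; apply: nS.
apply: S_disposal Sv _ _ => i /=; first by [].
rewrite !mxE eqxx /= add0r; case: eqP => [->|_]; first by rewrite mulr1 ltW.
by rewrite mulr0; have := v0 i; rewrite mxE.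
Qed.

Hypothesis s_gt0 : (0 < s)%N.
Local Notation T := (S `&` (orthant `*` orthant_neq0)).

(** Lowering the inputs of a point of T may leave the orthant, raising its
    outputs does not.  So if (p.1 - e, p.2 + e) is in S then, by disposal,
    (p.1, p.2 + e) is in T and dominates p. *)
Lemma strong_frontier_restrict p :
  T p -> strong_frontier T p <-> weak_frontier S p.
Proof.
move=> Tp; have [Sp [p1 [p2 p2N0]]] := Tp; split=> [[_ sTp]|].
  apply/weak_frontierP; split=> // e e0 Se.
  apply: (sTp (p.1, p.2 + const_mx e)).
  - apply/netput_le; split=> i /=; rewrite ?mxE ?lexx //; lra.
  - move/netput_inj/(congr1 (fun q : _ * 'rV[R]_s => q.2 0 (Ordinal s_gt0))).
    by rewrite /= !mxE; lra.
  have lt0 i : 0 < p.2 0 i + e by have := p2 i; rewrite mxE; lra.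
  split.
    by apply: S_disposal Se _ _ => i /=; rewrite !mxE; lra.
  split=> //=; split=> [i|]; first by rewrite !mxE ltW.
  move/(congr1 (fun v : 'rV[R]_s => v 0 (Ordinal s_gt0))).
  by have := lt0 (Ordinal s_gt0); rewrite !mxE => /gt_eqF/eqP.
rewrite -S_frontiers => -[_ sp]; split=> // q le_qp neq [Sq _].
exact: sp le_qp neq Sq.
Qed.

(** * Feasible scalings *)

Definition rescale (p q : 'rV[R]_m * 'rV[R]_s) : 'rV[R]_m * 'rV[R]_s :=
  (hadamard q.1 p.1, hadamard q.2 p.2).

Definition scale_box : set ('rV[R]_m * 'rV[R]_s) :=
  [set q : 'rV[R]_m * 'rV[R]_s |
    (forall i, 0 <= q.1 0 i <= 1) /\ (forall r, 1 <= q.2 0 r)].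

Lemma rescale_continuous p : continuous (rescale p).
Proof.
apply: continuous_pair; apply: rV_continuous => i q.
  rewrite /hadamard; under [X in continuous_at _ X]eq_fun do rewrite mxE.
  by apply: cvgM; [exact: input_coord_continuous|exact: cvg_cst].
rewrite /hadamard; under [X in continuous_at _ X]eq_fun do rewrite mxE.
by apply: cvgM; [exact: output_coord_continuous|exact: cvg_cst].
Qed.

Lemma rescale1 p : rescale p (const_mx 1, const_mx 1) = p.
Proof.
by case: p => u v; congr (_, _); apply/rowP => i; rewrite !mxE mul1r.
Qed.

Lemma positive_output p : T p -> exists r, 0 < p.2 0 r.
Proof.
move=> [_ [_ [p2 p2N0]]]; apply: contrapT => none; apply: p2N0 => /=.
apply/rowP => r; apply/eqP; rewrite eq_le; apply/andP; split; last exact: p2.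
by rewrite mxE leNgt; apply/negP => pr; apply: none; exists r.
Qed.

Lemma russell_feasibleP p q :
  T p -> russell_feasible T p q <-> weak_frontier S (rescale p q) /\ scale_box q.
Proof.
move=> Tp; have [Sp [p1 [p2 p2N0]]] := Tp.
have box_T : S (rescale p q) -> scale_box q -> T (rescale p q).
  move=> Sq [b1 b2]; split=> //; split=> /=.
    move=> i; rewrite !mxE mulr_ge0 //; first by case/andP: (b1 i).
    by have := p1 i; rewrite mxE.
  split=> [r|]; first rewrite !mxE mulr_ge0 //.
  - exact: le_trans ler01 (b2 r).
  - by have := p2 r; rewrite mxE.
  have [r pr] := positive_output Tp.
  move/(congr1 (fun v : 'rV[R]_s => v 0 r)); rewrite !mxE => /eqP.
  by rewrite gt_eqF // mulr_gt0 // (lt_le_trans ltr01).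
split=> [[sf b1 b2]|[wf [b1 b2]]].
  split=> //; apply/strong_frontier_restrict => //; first by case: sf.
split=> //; apply/strong_frontier_restrict => //.
by apply: box_T => //; case: wf.
Qed.

Lemma feasible_crossing p (f : R -> 'rV[R]_m * 'rV[R]_s) :
  T p -> continuous f -> (forall t, 0 <= t < 1 -> scale_box (f t)) ->
  S (rescale p (f 0)) -> ~ S (rescale p (f 1)) ->
  exists2 t, 0 <= t < 1 & russell_feasible T p (f t).
Proof.
move=> Tp fC fbox S0 S1.
have [t t01 wt] : exists2 t, 0 <= t < 1 & weak_frontier S (rescale p (f t)).
  apply: (@frontier_crossing (rescale p \o f)) => // t.
  by apply: continuous_comp; [exact: fC|exact: rescale_continuous].
by exists t => //; apply/russell_feasibleP => //; split=> //; exact: fbox.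
Qed.

(** Since input factors are at most 1, the rescaled outputs are also producible
    from the unscaled inputs, whose outputs are bounded. *)
Lemma rescale_output_bounded p r : T p ->
  exists B, forall q, scale_box q -> S (rescale p q) -> q.2 0 r * p.2 0 r <= B.
Proof.
move=> [Sp [p1 [p2 _]]]; have [B hB] := output_bounded p.1 r.
exists B => q [b1 b2] Sq.
have -> : q.2 0 r * p.2 0 r = (rescale p q).2 0 r by rewrite mxE.
apply: hB => [i|].
  rewrite !mxE mulr_ge0 // ?(le_trans ler01 (b2 i)) //.
  by have := p2 i; rewrite mxE.
apply: S_disposal Sq _ _ => i //=; rewrite mxE.
case/andP: (b1 i) => _ /ler_wpM2r; rewrite -[X in _ <= X]mul1r; apply.
by have := p1 i; rewrite mxE.
Qed.

Lemma rescale_escape p q r : T p -> scale_box q -> 0 < p.2 0 r ->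
  exists2 N, 0 <= N & ~ S (rescale p (q.1, q.2 + N *: delta_mx 0 r)).
Proof.
move=> Tp [b1 b2] pr; have [B hB] := rescale_output_bounded r Tp.
(* With this N the r-th rescaled output exceeds |B|. *)
pose N := `|B| / p.2 0 r.
have N0 : 0 <= N by rewrite divr_ge0 // ltW.
exists N => // Sq.
have box_q : scale_box (q.1, q.2 + N *: delta_mx 0 r).
  split=> // i /=; rewrite !mxE.
  by rewrite (le_trans (b2 i)) // lerDl mulr_ge0 // ler0n.
have := hB _ box_q Sq; rewrite /= !mxE !eqxx mulr1 mulrDl divfK ?gt_eqF //.
have : 0 < q.2 0 r * p.2 0 r by rewrite mulr_gt0 // (lt_le_trans ltr01).
have := ler_norm B.
lra.
Qed.

Lemma ray_continuous (u : 'rV[R]_m) (v w : 'rV[R]_s) (N : R) :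
  continuous (fun t : R => (u, v + (t * N) *: w)).
Proof.
apply: continuous_pair => t; first exact: cvg_cst.
apply: cvgD; first exact: cvg_cst.
apply: cvgZr_tmp; apply: cvgM; [exact: cvg_id|exact: cvg_cst].
Qed.

(** Provides feasible scalings: one from the trivial scaling, and one that trades
    a larger input factor for a larger output factor. *)
Lemma raise_output_feasible p q r : T p -> scale_box q ->
  S (rescale p q) -> 0 < p.2 0 r ->
  exists2 c, 0 <= c & russell_feasible T p (q.1, q.2 + c *: delta_mx 0 r).
Proof.
move=> Tp bq Sq pr; have [N N0 nS] := rescale_escape Tp bq pr.
have [t /andP[t0 _] ft] : exists2 t, 0 <= t < 1 &
    russell_feasible T p (q.1, q.2 + (t * N) *: delta_mx 0 r).
  apply: (@feasible_crossing p
    (fun t => (q.1, q.2 + (t * N) *: delta_mx 0 r))) => //.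
  - exact: ray_continuous.
  - case: bq => b1 b2 t /andP[t0 _]; split=> // i /=; rewrite !mxE.
    by rewrite (le_trans (b2 i)) // lerDl !mulr_ge0 // ler0n.
  - by rewrite mul0r scale0r addr0; case: (q) Sq.
  - by rewrite mul1r.
by exists (t * N) => //; rewrite mulr_ge0.
Qed.

(** * The Russell objective and its maximum *)

Lemma russell_obj_mono (a a' : 'rV[R]_m) (b b' : 'rV[R]_s) :
  lev a' a -> lev (const_mx 1) b -> lev b b' ->
  russell_obj a' b' <= russell_obj a b /\
  (russell_obj a' b' = russell_obj a b -> a' = a /\ b' = b).
Proof.
move=> aa b1 bb.
have b0 r : 0 < b 0 r by rewrite (lt_le_trans ltr01) //; have := b1 r; rewrite mxE.
have b'0 r : 0 < b' 0 r by rewrite (lt_le_trans (b0 r)).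
have c0 : 0 < (m + s)%:R^-1 :> R by rewrite invr_gt0 ltr0n addn_gt0 s_gt0 orbT.
have da i : 0 <= a 0 i - a' 0 i by rewrite subr_ge0.
have db r : 0 <= (b 0 r)^-1 - (b' 0 r)^-1.
  by rewrite subr_ge0 lef_pV2 ?posrE.
have gap : russell_obj a b - russell_obj a' b' = (m + s)%:R^-1 *
    (\sum_i (a 0 i - a' 0 i) + \sum_r ((b 0 r)^-1 - (b' 0 r)^-1)).
  by rewrite /russell_obj !sumrB; ring.
have sa0 : 0 <= \sum_i (a 0 i - a' 0 i) by rewrite sumr_ge0.
have sb0 : 0 <= \sum_r ((b 0 r)^-1 - (b' 0 r)^-1) by rewrite sumr_ge0.
split; first by rewrite -subr_ge0 gap mulr_ge0 ?addr_ge0 // ltW.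
move/esym/eqP; rewrite -subr_eq0 gap mulf_eq0 gt_eqF //= paddr_eq0 //.
case/andP=> /eqP Ea /eqP Eb; split; apply/rowP => i; apply/eqP.
  by rewrite eq_sym -subr_eq0; apply/eqP/(psumr_eq0P _ Ea).
rewrite -(inj_eq invr_inj) eq_sym -subr_eq0.
by apply/eqP/(psumr_eq0P _ Eb).
Qed.

Lemma russell_obj_continuous (q : 'rV[R]_m * 'rV[R]_s) : scale_box q ->
  {for q, continuous (fun q : 'rV[R]_m * 'rV[R]_s => russell_obj q.1 q.2)}.
Proof.
move=> [_ b2]; rewrite /russell_obj.
apply: cvgM; first exact: cvg_cst.
apply: cvgD; apply: cvg_big => [|i _]; try exact: add_continuous.
  exact: input_coord_continuous.
exact: cvgV (lt0r_neq0 (lt_le_trans ltr01 (b2 i)))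
  (@output_coord_continuous R m s i q).
Qed.

Definition russell_optimal p q :=
  russell_feasible T p q /\ forall q', russell_feasible T p q' ->
    russell_obj q'.1 q'.2 <= russell_obj q.1 q.2.

(** The factors of positive outputs are bounded by [rescale_output_bounded].  The
    factor of a zero output is unconstrained, but resetting it to 1 keeps the
    rescaled point and does not lower the objective, so the maximum may be
    sought on the compact set C. *)
Lemma russell_optimal_exists p : T p -> exists q, russell_optimal p q.
Proof.
move=> Tp; have [Sp [p1 [p2 _]]] := Tp.
have /choice[B hB] r := rescale_output_bounded r Tp.
pose M r : R := if p.2 0 r == 0 then 1 else B r / p.2 0 r.
pose Box : set ('rV[R]_m * 'rV[R]_s) :=
  [set u : 'rV[R]_m | forall i : 'I_m, `[0, 1] (u ord0 i)] `*`
  [set v : 'rV[R]_s | forall r : 'I_s, `[1, M r] (v ord0 r)].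
pose C := Box `&` rescale p @^-1` weak_frontier S.
have C_compact : compact C.
  apply: compact_closedI.
    apply: compact_setX.
      by apply: (@rV_compact R m (fun=> `[0, 1])) => i; exact: segment_compact.
    apply: (@rV_compact R s (fun r => `[1, M r])) => r.
    exact: segment_compact.
  apply: closed_comp; last exact: weak_frontier_closed.
  by move=> q _; exact: rescale_continuous.
have C_box q : C q -> scale_box q.
  move=> [[/= b1 b2] _]; split=> i.
    by have := b1 i; rewrite in_itv.
  by have := b2 i; rewrite in_itv => /andP[].
have feasible_C q : C q -> russell_feasible T p q.
  by move=> Cq; apply/russell_feasibleP => //; split;
    [case: Cq | exact: C_box].
have C_dominates q : russell_feasible T p q ->
    exists2 q', C q' & russell_obj q.1 q.2 <= russell_obj q'.1 q'.2.
  move=> /(russell_feasibleP _ Tp)[wq [b1 b2]].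
  pose b' : 'rV[R]_s := \row_r if p.2 0 r == 0 then 1 else q.2 0 r.
  have b'1 : lev (const_mx 1) b' by move=> r; rewrite !mxE; case: ifP.
  have bb' : lev b' q.2 by move=> r; rewrite !mxE; case: ifP.
  exists (q.1, b'); last exact: (russell_obj_mono (fun=> lexx _) b'1 bb').1.
  split.
    split=> i /=; rewrite in_itv //= !mxE /M.
    case: eqP => [|/eqP pi0]; first by rewrite lexx.
    rewrite b2 ler_pdivlMr; last by rewrite lt_def pi0; have := p2 i; rewrite mxE.
    by apply: hB; case: wq.
  rewrite /= (_ : rescale p (q.1, b') = rescale p q) //.
  congr (_, _); apply/rowP => r; rewrite !mxE.
  by case: eqP => // ->; rewrite !mulr0.
have C_nonempty : C !=set0.
  have [r pr] := positive_output Tp.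
  have [|||c _ fc] := @raise_output_feasible p (const_mx 1, const_mx 1) r Tp.
  - by split=> i /=; rewrite mxE ?ler01 lexx.
  - by rewrite rescale1.
  - by [].
  by have [q Cq _] := C_dominates _ fc; exists q.
have [|q /set_mem Cq qmax] := @compact_EVT_max _ R
    (fun q : 'rV[R]_m * 'rV[R]_s => russell_obj q.1 q.2) C C_nonempty C_compact.
  apply: continuous_in_subspaceT => q /set_mem /C_box.
  exact: russell_obj_continuous.
exists q; split; first exact: feasible_C.
move=> q' /C_dominates[q'' Cq'' /le_trans]; apply.
by apply: qmax; exact: mem_set.
Qed.

Lemma max_russell_optimal p q :
  russell_optimal p q -> max_russell T p = (russell_obj q.1 q.2)%:E.
Proof.
move=> [fq qmax]; apply: xget_unique.
  exists (russell_obj q.1 q.2) => //; split; first by exists q.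
  by move=> _ [q' fq' <-]; exact: qmax.
move=> _ [_ [[q' fq' <-] ub] <-]; congr EFin; apply/eqP.
by rewrite eq_le qmax //=; apply: ub; exists q.
Qed.

(** Otherwise raise a zero input factor to 1, which gains 1; the new point is
    still in S because inputs only increase.  Going back to the frontier by one
    output factor phi loses less than 1 / phi <= 1. *)
Lemma optimal_inputs_gt0 p q :
  T p -> russell_optimal p q -> forall i, 0 < q.1 0 i.
Proof.
move=> Tp [/(russell_feasibleP _ Tp)[wq bq] qmax] i; have [b1 b2] := bq.
case/andP: (b1 i); rewrite le_eqVlt => /predU1P[/esym qi0|//] _; exfalso.
have [Sp [p1 _]] := Tp; have [r pr] := positive_output Tp.
pose q1 := (q.1 + delta_mx 0 i, q.2).
have q1E j : q1.1 0 j = if j == i then 1 else q.1 0 j.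
  by rewrite !mxE eqxx; case: eqP => [->|_]; rewrite /= ?qi0 ?add0r ?addr0.
have [|||c c0 fc] := @raise_output_feasible p q1 r Tp.
- by split=> // j; rewrite q1E; case: ifP; rewrite ?ler01 ?lexx.
- apply: S_disposal (wq.1) _ _ => j /=; last by [].
  rewrite !mxE ler_wpM2r //; first by have := p1 j; rewrite mxE.
  by rewrite lerDl ler0n.
- by [].
have := qmax _ fc; apply/negP; rewrite -ltNge /russell_obj.
rewrite ltr_pM2l; last by rewrite invr_gt0 ltr0n addn_gt0 s_gt0 orbT.
have -> : \sum_j (q.1 + delta_mx 0 i) 0 j = \sum_j q.1 0 j + 1.
  rewrite (bigD1 i) //= [in RHS](bigD1 i) //= !mxE !eqxx.
  under eq_bigr => j /negPf ji do rewrite !mxE ji addr0.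
  by rewrite addrAC.
rewrite /= (bigD1 r) //= [X in _ < _ + X](bigD1 r) //= !mxE !eqxx mulr1.
under [X in _ < _ + (_ + X)]eq_bigr => j /negPf jr do
  rewrite !mxE jr andbF mulr0 addr0.
have qr0 : 0 < q.2 0 r by rewrite (lt_le_trans ltr01).
have : (q.2 0 r)^-1 <= 1 by rewrite invf_le1.
have : 0 < (q.2 0 r + c)^-1 by rewrite invr_gt0; lra.
lra.
Qed.

(** * The two properties *)

Lemma max_russell_indication p :
  T p -> max_russell T p = 1%:E <-> strong_frontier T p.
Proof.
move=> Tp; have [q oq] := russell_optimal_exists Tp.
rewrite (max_russell_optimal oq).
have [fq qmax] := oq; have /(russell_feasibleP _ Tp)[wq [b1 b2]] := fq.
pose e1 : 'rV[R]_m := const_mx 1; pose e2 : 'rV[R]_s := const_mx 1.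
have obj1 : russell_obj e1 e2 = 1.
  rewrite /russell_obj; under eq_bigr do rewrite mxE.
  under [X in _ + X]eq_bigr do rewrite mxE invr1.
  rewrite !sumr_const !card_ord -natrD mulVf //.
  by rewrite pnatr_eq0 -lt0n addn_gt0 s_gt0 orbT.
have [| | |le1 eq1] := @russell_obj_mono e1 q.1 e2 q.2.
- by move=> i; rewrite mxE; case/andP: (b1 i).
- by move=> i; rewrite mxE lexx.
- by move=> i; rewrite mxE.
split=> [[E]|sp].
  have [E1 E2] := eq1 (etrans E (esym obj1)).
  have -> : p = rescale p q by rewrite -{1}(rescale1 p) /rescale E1 E2.
  by case: fq.
congr EFin; apply: le_anti; rewrite -{1}obj1 le1 -obj1.
apply: (qmax (e1, e2)); apply/(russell_feasibleP _ Tp).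
rewrite rescale1; split; first exact/strong_frontier_restrict.
by split=> i /=; rewrite mxE ?ler01 lexx.
Qed.

(** The frontier point on the segment from the trivial scaling to q', taken for
    the dominating point p, is feasible and strictly better than q'. *)
Lemma max_russell_monotone p p' :
  T p -> T p' -> lev (netput p) (netput p') -> netput p <> netput p' ->
  (max_russell T p' < max_russell T p)%E.
Proof.
move=> Tp Tp' /netput_le[le1 le2] neq.
have [q oq] := russell_optimal_exists Tp.
have [q' oq'] := russell_optimal_exists Tp'.
rewrite (max_russell_optimal oq) (max_russell_optimal oq') lte_fin.
have /(russell_feasibleP _ Tp')[wq' [b1 b2]] := oq'.1.
have [Sp _] := Tp.
(* rescale p q' dominates the strongly efficient point rescale p' q'.  Equality
   of the two would give p = p', because all factors in q' are positive. *)
have nS : ~ S (rescale p q').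
  move: wq'; rewrite -S_frontiers => -[_ sq'] Sq'; apply: neq; congr netput.
  have : netput (rescale p' q') = netput (rescale p q').
    apply: contrapT => /sq'; apply=> //; apply/netput_le; split=> i /=.
      by rewrite !mxE ler_wpM2l //; case/andP: (b1 i).
    by rewrite !mxE ler_wpM2l // (le_trans ler01).
  move/netput_inj => E.
  rewrite [p]surjective_pairing [p']surjective_pairing.
  congr (_, _); apply/rowP => i.
    have := congr1 (fun w : 'rV[R]_m * 'rV[R]_s => w.1 0 i) E.
    rewrite /= !mxE => /esym; apply: mulfI.
    by rewrite gt_eqF // (optimal_inputs_gt0 Tp' oq').
  have := congr1 (fun w : 'rV[R]_m * 'rV[R]_s => w.2 0 i) E.
  rewrite /= !mxE => /esym; apply: mulfI.
  by rewrite gt_eqF // (lt_le_trans ltr01).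
pose one : 'rV[R]_m * 'rV[R]_s := (const_mx 1, const_mx 1).
pose f t := (1 - t) *: one + t *: q'.
have f1 t i : (f t).1 0 i = q'.1 0 i + (1 - t) * (1 - q'.1 0 i).
  by rewrite !mxE; ring.
have f2 t i : (f t).2 0 i = 1 + t * (q'.2 0 i - 1).
  by rewrite !mxE; ring.
have f2_ge1 t i : 0 <= t -> 1 <= (f t).2 0 i.
  by move=> t0; rewrite f2 lerDl mulr_ge0 // subr_ge0.
have f1_ge t i : t <= 1 -> q'.1 0 i <= (f t).1 0 i.
  move=> t1; rewrite f1 lerDl mulr_ge0 ?subr_ge0 //.
  by case/andP: (b1 i).
have [||||t /andP[t0 t1] ft] := @feasible_crossing p f Tp.
- exact: segment_continuous.
- move=> t /andP[t0 /ltW t1]; split=> i; last exact: f2_ge1.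
  have /andP[q0 q1] := b1 i; rewrite (le_trans q0 (f1_ge _ _ t1)) /=.
  have := mulr_ge0 t0 (_ : 0 <= 1 - q'.1 0 i); rewrite f1 subr_ge0 => /(_ q1).
  lra.
- by rewrite /f subr0 scale1r scale0r addr0 rescale1.
- by rewrite /f subrr scale0r scale1r add0r.
apply: lt_le_trans (oq.2 _ ft).
have [| | |le eq] := @russell_obj_mono (f t).1 q'.1 (f t).2 q'.2.
- by move=> i; apply/f1_ge/ltW.
- by move=> i; rewrite mxE; exact: f2_ge1.
- move=> i; rewrite f2 -subr_ge0.
  have -> : q'.2 0 i - (1 + t * (q'.2 0 i - 1)) = (1 - t) * (q'.2 0 i - 1).
    by ring.
  by rewrite mulr_ge0 // subr_ge0 // ltW.
rewrite lt_neqAle le andbT; apply/eqP => /eq[E1 E2]; apply: nS.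
have t1N0 : 1 - t != 0 by rewrite subr_eq0 gt_eqF.
suff -> : q' = one by rewrite rescale1.
rewrite [q']surjective_pairing; congr (_, _); apply/rowP => i.
  have := congr1 (fun v : 'rV[R]_m => v 0 i) E1; rewrite f1 => /eqP.
  rewrite -subr_eq0 opprD addNKr oppr_eq0 mulf_eq0 (negPf t1N0) /=.
  by rewrite subr_eq0 mxE => /eqP.
have := congr1 (fun v : 'rV[R]_s => v 0 i) E2; rewrite f2 => /eqP.
have -> : (q'.2 0 i == 1 + t * (q'.2 0 i - 1)) =
    ((1 - t) * (q'.2 0 i - 1) == 0).
  by rewrite -subr_eq0; congr (_ == 0); ring.
by rewrite mulf_eq0 (negPf t1N0) /= subr_eq0 mxE => /eqP.
Qed.

End ProductionSet.

Theorem theorem4p2 (R : realType) (m s n K : nat)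
    (m_gt0 : (0 < m)%N) (s_gt0 : (0 < s)%N)
    (n_gt0 : (0 < n)%N) (K_gt0 : (0 < K)%N)
    (x : 'I_n -> 'rV[R]_m) (y : 'I_n -> 'rV[R]_s)
    (rm : 'I_K -> 'rV[R]_m) (rp : 'I_K -> 'rV[R]_s)
    (hx : forall j, orthant_neq0 (x j))
    (hy : forall j, orthant_neq0 (y j))
    (P_proper : PTO x y rm rp <> setT)
    (P_frontiers :
      strong_frontier (PTO x y rm rp) = weak_frontier (PTO x y rm rp)) :
  let T := TVRSTO x y rm rp in
  (forall p, T p -> (max_russell T p = 1%:E <-> strong_frontier T p)) /\
  (forall p p', T p -> T p' ->
     lev (netput p) (netput p') -> netput p <> netput p' ->
     (max_russell T p' < max_russell T p)%E).
Proof.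
move=> T; have closedP := @PTO_closed R m s n K x y rm rp.
have disposalP := @PTO_disposal R m s n K x y rm rp.
have convexP := @PTO_convex R m s n K x y rm rp.
split=> [p Tp|p p' Tp Tp' le neq].
  exact: (max_russell_indication closedP disposalP convexP P_proper P_frontiers).
exact: (max_russell_monotone closedP disposalP convexP P_proper P_frontiers).
Qed.
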